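(* Let $X$ be a completely regular Hausdorff space. The following statements are equivalent. (1) $C(X)$ is a $PW$-ring. (2) $X$ is a $WCF$-space. (3) $C^*(X)$ is a $PW$-ring.
   Context: $C(X)$ (resp. $C^*(X)$) is the ring of all (resp. all bounded) real-valued continuous functions on $X$. For $f\in C(X)$, the zero-set of $f$ is $Z(f)=f^{-1}(\{0\})$ and the cozero-set of $f$ is $X\setminus Z(f)$. $X$ is a $WCF$-space if for every two disjoint cozero-sets $A,B$ of $X$ there exist zero-sets $Z_1,Z_2$ of $X$ with $A\subseteq Z_1$, $B\subseteq Z_2$ and $\mathrm{int}\,Z_1\cap \mathrm{int}\,Z_2=\emptyset$. A commutative ring $R$ with unity is a $PW$-ring if for all $a,b\in R$ with $aR\cap bR=0$ the ideal $\mathrm{Ann}(a)+\mathrm{Ann}(b)$ contains a regular element (non-zero-divisor), where $\mathrm{Ann}(a)=\{r\in R: ra=0\}$. *)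

(* Defs.v *)
From HB Require Import structures.
From mathcomp Require Import all_boot all_order all_algebra.
From mathcomp Require Import all_classical all_reals all_analysis.

Set Implicit Arguments.
Unset Strict Implicit.
Unset Printing Implicit Defensive.

Import Order.TTheory GRing.Theory Num.Theory.
Import numFieldNormedType.Exports.

Local Open Scope classical_set_scope.
Local Open Scope ring_scope.

(* C(X) is the library's type [continuousType X R] of continuous functions,
   made a subring of the pointwise ring [X -> R]. The possibly trivial rings
   [comPzRingType] are used because C(X) is the zero ring when X is empty. *)
Section continuous_functions.
Context (X : topologicalType) (R : realType).

Definition continuous_pred : {pred X -> R} :=
  mem [set f : X -> R | continuous f].

Definition continuous_Sub (f : X -> R) (cf : f \in continuous_pred) :
  continuousType X R := mkcts (set_mem cf).

Lemma continuous_rect (K : continuousType X R -> Type) :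
  (forall f (cf : f \in continuous_pred), K (continuous_Sub cf)) ->
  forall f : continuousType X R, K f.
Proof.
move=> Ksub f; have cf : (f : X -> R) \in continuous_pred.
  by apply/mem_set; exact: cts_fun.
by have -> : f = continuous_Sub cf by apply/continuousEP.
Qed.

Lemma continuous_SubK (f : X -> R) (cf : f \in continuous_pred) :
  continuous_Sub cf = f :> (X -> R).
Proof. by []. Qed.

HB.instance Definition _ := isSub.Build (X -> R) (fun f => f \in continuous_pred)
  (continuousType X R) continuous_rect continuous_SubK.

Lemma continuous_subring_closed : subring_closed continuous_pred.
Proof.
split=> [|f g /set_mem/= cf /set_mem/= cg|f g /set_mem/= cf /set_mem/= cg];
  apply/mem_set => /= x.
- exact: cvg_cst.
- by apply: cvgB; [exact: cf|exact: cg].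
- by apply: cvgM; [exact: cf|exact: cg].
Qed.

HB.instance Definition _ := GRing.SubChoice_isSubComPzRing.Build (X -> R)
  (fun f => f \in continuous_pred) (continuousType X R)
  continuous_subring_closed.

End continuous_functions.

Section bounded_continuous_functions.
Context (X : topologicalType) (R : realType).

Definition bounded_pred : {pred continuousType X R} :=
  mem [set f : continuousType X R | bounded_fun (f : X -> R)].

Lemma bounded_subring_closed : subring_closed bounded_pred.
Proof.
split=> [|f g /set_mem/= bf /set_mem/= bg|f g /set_mem/= bf /set_mem/= bg];
  apply/mem_set => /=.
- exact: bounded_cst.
- have [M [_ Mf]] := bf; have [N [_ Ng]] := bg.
  exists (`|M| + 1 + (`|N| + 1)); split; first exact: num_real.
  move=> r ltr x _ /=; apply: le_trans (ltW ltr).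
  apply: le_trans (ler_normB _ _) _; apply: lerD.
    by apply: Mf => //; rewrite (le_lt_trans (ler_norm _))// ltrDl.
  by apply: Ng => //; rewrite (le_lt_trans (ler_norm _))// ltrDl.
- have [M [_ Mf]] := bf; have [N [_ Ng]] := bg.
  exists ((`|M| + 1) * (`|N| + 1)); split; first exact: num_real.
  move=> r ltr x _ /=; apply: le_trans (ltW ltr).
  rewrite normrM; apply: ler_pM => //.
    by apply: Mf => //; rewrite (le_lt_trans (ler_norm _))// ltrDl.
  by apply: Ng => //; rewrite (le_lt_trans (ler_norm _))// ltrDl.
Qed.

Record boundedContinuousType := BoundedContinuous {
  bounded_val :> continuousType X R;
  bounded_valP : bounded_val \in bounded_pred }.

HB.instance Definition _ := [isSub of boundedContinuousType for bounded_val].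
HB.instance Definition _ := [Choice of boundedContinuousType by <:].
HB.instance Definition _ := GRing.SubChoice_isSubComPzRing.Build
  (continuousType X R) (fun f => f \in bounded_pred) boundedContinuousType
  bounded_subring_closed.

End bounded_continuous_functions.

Section pointwise_operations.
Context (X : topologicalType) (R : realType).

Lemma continuous_ringE (f g : continuousType X R) :
  [/\ (f + g : continuousType X R) = (fun x => f x + g x) :> (X -> R),
      (f * g : continuousType X R) = (fun x => f x * g x) :> (X -> R),
      (- f : continuousType X R) = (fun x => - f x) :> (X -> R),
      (0 : continuousType X R) = (fun=> 0) :> (X -> R) &
      (1 : continuousType X R) = (fun=> 1) :> (X -> R)].
Proof. by []. Qed.

Lemma bounded_continuous_ringE (f g : boundedContinuousType X R) :
  [/\ (f + g : boundedContinuousType X R) = (fun x => f x + g x) :> (X -> R),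
      (f * g : boundedContinuousType X R) = (fun x => f x * g x) :> (X -> R),
      (- f : boundedContinuousType X R) = (fun x => - f x) :> (X -> R),
      (0 : boundedContinuousType X R) = (fun=> 0) :> (X -> R) &
      (1 : boundedContinuousType X R) = (fun=> 1) :> (X -> R)].
Proof. by []. Qed.

End pointwise_operations.

Section PW_ring.
Context (A : comPzRingType).

Definition principal_ideal (a : A) : set A := [set a * r | r in [set: A]].

Definition annihilator (a : A) : set A := [set r | r * a = 0].

Definition ideal_sum (I J : set A) : set A := [set x + y | x in I & y in J].

(* [GRing.lreg r] says that multiplication by r is injective, i.e. that r is
   regular since A is commutative. *)
Definition PW_ring : Prop := forall a b : A,
  principal_ideal a `&` principal_ideal b = [set 0] ->
  exists2 r, ideal_sum (annihilator a) (annihilator b) r & GRing.lreg r.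

End PW_ring.

Section WCF_space.
Context (R : realType) (X : topologicalType).

Definition zero_set (f : X -> R) : set X := f @^-1` [set 0].

Definition is_zero_set (Z : set X) : Prop :=
  exists f : continuousType X R, Z = zero_set f.

Definition is_cozero_set (A : set X) : Prop :=
  exists f : continuousType X R, A = ~` zero_set f.

Definition WCF_space : Prop := forall A B : set X,
  is_cozero_set A -> is_cozero_set B -> A `&` B = set0 ->
  exists Z1 Z2 : set X,
    [/\ is_zero_set Z1, is_zero_set Z2, A `<=` Z1, B `<=` Z2 &
        Z1° `&` Z2° = set0].

End WCF_space.

(* Main.v *)
Require Import Defs.
From mathcomp Require Import all_boot all_order all_algebra.
From mathcomp Require Import all_classical all_reals all_analysis.
Import numFieldNormedType.Exports.

(** Both rings are covered by one argument: if a ring of functions has exactly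
    the zero-sets of X as zero-sets of its elements, then it is PW iff X is WCF.
    Such a ring is reduced, so aR and bR meet trivially iff ab = 0, that is, iff
    the cozero-sets of a and b are disjoint; f lies in Ann(a) iff Z(f) contains
    the cozero-set of a; and by complete regularity an element is regular iff its
    zero-set has empty interior. Given zero-sets Z(f) and Z(g) as in WCF, the
    regular element is f^2 + g^2, with zero-set Z(f) `&` Z(g). *)

Import Order.TTheory GRing.Theory Num.Theory.
Local Open Scope classical_set_scope.
Local Open Scope ring_scope.

Section function_ring.
Context (R : realType) (X : topologicalType) (A : comPzRingType).
Context (ev : {rmorphism A -> (X -> R)}).
Context (ev_inj : injective ev).
Context (zero_set_ev : forall a : A, is_zero_set R (zero_set (ev a))).
(** Only the zero-set of [f] has to be realised in [A], not [f] itself; this lets bounded functions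
    qualify. *)
Context (ev_zero_set : forall f : continuousType X R,
  exists a : A, zero_set (ev a) = zero_set f).

Let evD a b x : ev (a + b) x = ev a x + ev b x.
Proof. by rewrite rmorphD. Qed.

Let evM a b x : ev (a * b) x = ev a x * ev b x.
Proof. by rewrite rmorphM. Qed.

Let ev_eq0 a : (forall x, ev a x = 0) -> a = 0.
Proof. by move=> a0; apply: ev_inj; rewrite rmorph0; apply/funext. Qed.

Lemma mul_eq0_cozero_sub (a b : A) :
  a * b = 0 <-> ~` zero_set (ev b) `<=` zero_set (ev a).
Proof.
split=> [ab0 x /eqP bx0|ba].
  have : ev (a * b) x = 0 by rewrite ab0 rmorph0.
  by move=> /eqP; rewrite evM mulf_eq0 (negbTE bx0) orbF => /eqP.
apply: ev_eq0 => x; rewrite evM.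
have [->|/eqP/ba ->] := eqVneq (ev b x) 0; first by rewrite mulr0.
by rewrite mul0r.
Qed.

Lemma principal_ideal_setI_eq0 (a b : A) :
  principal_ideal a `&` principal_ideal b = [set 0] <-> a * b = 0.
Proof.
split=> [ab|ab0].
  suff : [set 0] (a * b) by [].
  by rewrite -ab; split; [exists b|exists a => //; rewrite mulrC].
apply/seteqP; split=> [c [[r _ <-] [s _ sr]]|_ ->]; last first.
  by split; exists 0; rewrite ?mulr0.
apply: ev_eq0 => x.
(* A common element [c = a * r = b * s] has square [(a * b) * (r * s) = 0], and a real number with
   zero square is zero. *)
have : ev ((a * r) * (b * s)) x = 0.
  by rewrite mulrACA ab0 mul0r rmorph0.
by move=> /eqP; rewrite evM sr mulf_eq0 orbb => /eqP.
Qed.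

Lemma lreg_zero_set_interior0 (a : A) : completely_regular_space X ->
  GRing.lreg a <-> (zero_set (ev a))° = set0.
Proof.
move=> crX; split=> [rega|a0 b c abc].
  rewrite -subset0 => x xa.
  (* Separate [x] from the complement of the interior by [h], with [h x = 0] and [h = 1] off the
     interior. Then [h - 1] vanishes wherever [ev a] does not, so an element [b] with its zero-set
     is killed by [a]; regularity forces [b = 0], although [h x - 1 = -1]. *)
  have : ~ (~` (zero_set (ev a))°) x by [].
  move=> /(crX x _ (open_closedC (open_interior _))).
  move=> /(@uniform_separatorP _ R)[h [ch _ /(_ (h x)) hx hout]].
  have {}hx : h x = 0 by apply: hx; exists x.
  have [b bh] : exists b, zero_set (ev b) = zero_set (fun y => h y - 1).
    have ch1 : continuous (fun y => h y - 1).
      by move=> y; apply: cvgB; [exact: ch|exact: cvg_cst].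
    exact: (ev_zero_set (mkcts ch1)).
  have ab0 : a * b = 0.
    apply/mul_eq0_cozero_sub; rewrite bh => y /= hy.
    apply: interior_subset; apply: contrapT => ya; apply: hy.
    by rewrite /zero_set /= (hout (h y)) ?subrr//; exists y.
  have b0 : b = 0 by apply: rega; rewrite ab0 mulr0.
  have : zero_set (fun y => h y - 1) x by rewrite -bh b0 rmorph0.
  by rewrite /zero_set /= hx sub0r => /eqP; rewrite oppr_eq0 oner_eq0.
apply/eqP; rewrite -subr_eq0; apply/eqP/ev_eq0 => x.
apply: contrapT => bcx.
suff : (zero_set (ev a))° x by rewrite a0.
(* Since [a * (b - c) = 0], the cozero-set of [b - c] lies in the zero-set of [a]; being open, it
   lies in the interior, which is empty. *)
have [f fE] := zero_set_ev (b - c).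
have sub : ~` zero_set (ev (b - c)) `<=` zero_set (ev a).
  by apply/mul_eq0_cozero_sub; rewrite mulrBr abc subrr.
rewrite open_subsetE in sub; first exact: sub.
rewrite fE; apply: closed_openC; apply: preimage_closed.
  by move=> y _; exact: cts_fun.
exact: closed_eq.
Qed.

Lemma PW_ring_WCF_space : completely_regular_space X ->
  PW_ring A <-> WCF_space R X.
Proof.
move=> crX; split=> [pwA _ _ [f ->] [g ->] fg|wcfX a b].
  have [a aE] := ev_zero_set f; have [b bE] := ev_zero_set g.
  have ab0 : a * b = 0.
    by apply/mul_eq0_cozero_sub; rewrite aE bE -[zero_set f]setCK -disjoints_subset setIC.
  have [r [u ua] [v vb] <-] := pwA a b ((principal_ideal_setI_eq0 a b).2 ab0).
  move=> /(lreg_zero_set_interior0 _ crX) uv0.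
  exists (zero_set (ev u)), (zero_set (ev v)); split=> //.
  - by rewrite -aE; apply/mul_eq0_cozero_sub.
  - by rewrite -bE; apply/mul_eq0_cozero_sub.
  (* Where [u] and [v] both vanish, so does the regular element [u + v]. *)
  - rewrite -subset0 -uv0 -interiorI; apply: interiorS => x [].
    by rewrite /zero_set /= evD => -> ->; rewrite addr0.
move=> /principal_ideal_setI_eq0 /mul_eq0_cozero_sub ba.
have coz c : is_cozero_set R (~` zero_set (ev c)).
  by have [f ->] := zero_set_ev c; exists f.
have ab : ~` zero_set (ev a) `&` ~` zero_set (ev b) = set0.
  by rewrite setIC disjoints_subset setCK.
have [_ [_ [[f ->] [g ->] af bg fg0]]] := wcfX _ _ (coz a) (coz b) ab.
(* [f] and [g] may lie outside the image of [ev], so they are replaced by elements of [A] with the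
   same zero-sets. *)
have [u uE] := ev_zero_set f; have [v vE] := ev_zero_set g.
exists (u * u + v * v).
  exists (u * u); last exists (v * v) => //.
    by rewrite /annihilator /= -mulrA (mul_eq0_cozero_sub u a).2 ?mulr0 ?uE.
  by rewrite /annihilator /= -mulrA (mul_eq0_cozero_sub v b).2 ?mulr0 ?vE.
apply/(lreg_zero_set_interior0 _ crX).
rewrite -subset0 -fg0 -interiorI; apply: interiorS => x.
rewrite -uE -vE /zero_set /= evD !evM => /eqP.
by rewrite paddr_eq0 -?expr2 ?sqr_ge0// !sqrf_eq0 => /andP[/eqP ? /eqP ?].
Qed.

End function_ring.

Lemma bounded_same_zero_set (R : realType) (X : topologicalType)
    (f : continuousType X R) :
  exists g : boundedContinuousType X R, zero_set g = zero_set f.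
Proof.
(* Truncating [|f|] at a positive height makes it bounded and creates no new zeros. *)
pose h x := Num.min `|f x| 1.
have ch : continuous h.
  move=> x; apply: (@continuous_min R X (fun y => `|f y|) (cst 1)).
    by apply: cvg_norm; exact: cts_fun.
  exact: cvg_cst.
have bh : (mkcts ch : continuousType X R) \in @bounded_pred X R.
  apply/mem_set; exists 1; split; first exact: num_real.
  move=> r r1 x _ /=; apply: le_trans (ltW r1).
  by rewrite /mkcts /h ger0_norm ?ge_min ?lexx ?orbT// le_min normr_ge0 ler01.
exists (BoundedContinuous bh); apply/seteqP; split=> x; rewrite /zero_set /=.
  rewrite /mkcts /h /Num.min; case: ifPn => _ => [/normr0_eq0//|/eqP].
  by rewrite oner_eq0.
by rewrite /mkcts /h => ->; rewrite normr0 minEle ler01.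
Qed.

Theorem theorem4p13 (R : realType) (X : topologicalType)
    (crX : completely_regular_space X) (hX : hausdorff_space X) :
  (PW_ring (continuousType X R) <-> WCF_space R X) /\
  (WCF_space R X <-> PW_ring (boundedContinuousType X R)).
Proof.
split.
  apply: (@PW_ring_WCF_space R X (continuousType X R) val) => //.
  - by move=> a; exists a.
  - by move=> f; exists f.
apply: iff_sym.
apply: (@PW_ring_WCF_space R X (boundedContinuousType X R) (val \o val)) => //.
- by apply: inj_comp; exact: val_inj.
- by move=> a; exists (val a).
- exact: bounded_same_zero_set.
Qed.
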